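(* Let $G$ be a compact Hausdorff topological group and let $\eta:G*X\to X$ be a continuous partial action of $G$ on a topological space $X$ such that $G*X$ is closed in $G\times X$. Let $\mathcal P$ be any one of the properties: Hausdorff, regular, metrizable, second countable. Then: (i) if $X$ has $\mathcal P$, then the orbit space $X/\!\sim_G$ has $\mathcal P$; (ii) if $G\times X$ has $\mathcal P$, then the enveloping space $X_G$ has $\mathcal P$.
   Context: A partial action of $G$ on $X$ is a function $\eta:G*X\to X$ with domain $G*X\subseteq G\times X$, written $g\cdot x=\eta(g,x)$, where ''$\exists g\cdot x$'' means $(g,x)\in G*X$, such that for all $g,h\in G$, $x\in X$: (PA1) if $\exists g\cdot x$ then $\exists g^{-1}\cdot(g\cdot x)$ and $g^{-1}\cdot(g\cdot x)=x$; (PA2) if $\exists g\cdot(h\cdot x)$ (in particular $\exists h\cdot x$) then $\exists (gh)\cdot x$ and $g\cdot(h\cdot x)=(gh)\cdot x$; (PA3) $\exists 1\cdot x$ and $1\cdot x=x$. Put $X_g=\{x\in X\mid \exists g^{-1}\cdot x\}$ and let $\eta_g:X_{g^{-1}}\to X_g$, $x\mapsto g\cdot x$, which is a bijection. All partial actions are assumed topological: every $X_g$ is open in $X$ and every $\eta_g$ is a homeomorphism. The partial action is continuous if $\eta:G*X\to X$ is continuous, where $G*X$ has the subspace topology from the product $G\times X$. Orbit equivalence relation: $x\sim_G y$ iff there is $g\in G$ with $\exists g\cdot x$ and $g\cdot x=y$; the orbit space $X/\!\sim_G$ has the quotient topology. The enveloping space of $\eta$ is $X_G=(G\times X)/R$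 with the quotient topology, where $(g,x)R(h,y)$ if and only if $x\in X_{g^{-1}h}$ and $\eta_{h^{-1}g}(x)=y$. *)

(* Defs.v *)
From HB Require Import structures.
From mathcomp Require Import all_boot all_order all_algebra.
From mathcomp Require Import all_classical all_reals.
From mathcomp Require Import topology.

Set Implicit Arguments.
Unset Strict Implicit.
Unset Printing Implicit Defensive.

Import Order.TTheory GRing.Theory Num.Theory.
Local Open Scope classical_set_scope.
Local Open Scope group_scope.

HB.mixin Record Topological_Group_isTopologicalGroup G
    & Topological G & Group G := {
  mulg_continuous : continuous (fun p : G * G => p.1 * p.2) ;
  invg_continuous : continuous (fun g : G => g^-1)
}.

#[short(type="topologicalGroupType")]
HB.structure Definition TopologicalGroup :=
  { G of Topological G & Group G & Topological_Group_isTopologicalGroup G }.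

(* The partial function eta : G*X -> X is encoded by its domain [pa_dom] and a
   total function [pa_act] of which only the values on [pa_dom] are ever used.
   Every partial action arises in this way, since 1 . x always exists. *)
Record partial_action (G : groupType) (X : Type) := PartialAction {
  pa_dom : set (G * X) ;
  pa_act :> G -> X -> X ;
  _ : forall g x, pa_dom (g, x) ->
        pa_dom (g^-1, pa_act g x) /\ pa_act g^-1 (pa_act g x) = x ;
  _ : forall g h x, pa_dom (h, x) -> pa_dom (g, pa_act h x) ->
        pa_dom (g * h, x) /\ pa_act g (pa_act h x) = pa_act (g * h) x ;
  _ : forall x, pa_dom (1, x) /\ pa_act 1 x = x
}.

Section PartialActionAxioms.
Context {G : groupType} {X : Type} (eta : partial_action G X).

Lemma paV g x : pa_dom eta (g, x) ->
  pa_dom eta (g^-1, eta g x) /\ eta g^-1 (eta g x) = x.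
Proof. by case: eta => D a PA1 PA2 PA3; exact: PA1. Qed.

Lemma paM g h x : pa_dom eta (h, x) -> pa_dom eta (g, eta h x) ->
  pa_dom eta (g * h, x) /\ eta g (eta h x) = eta (g * h) x.
Proof. by case: eta => D a PA1 PA2 PA3; exact: PA2. Qed.

Lemma pa1 x : pa_dom eta (1, x) /\ eta 1 x = x.
Proof. by case: eta => D a PA1 PA2 PA3; exact: PA3. Qed.

(* the set X_g *)
Definition pa_ran (g : G) : set X := [set x | pa_dom eta (g^-1, x)].

Definition orbit_rel (x y : X) : Prop :=
  exists g, pa_dom eta (g, x) /\ eta g x = y.

Definition enveloping_rel (p q : G * X) : Prop :=
  pa_ran (p.1^-1 * q.1) p.2 /\ eta (q.1^-1 * p.1) p.2 = q.2.

Let orbit_relb : rel X := fun x y => `[< orbit_rel x y >].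

Lemma orbit_rel_refl : reflexive orbit_relb.
Proof. by move=> x; apply/asboolP; exists 1; exact: pa1. Qed.

Lemma orbit_rel_sym : symmetric orbit_relb.
Proof.
have H x y : orbit_rel x y -> orbit_rel y x.
  by move=> [g [/paV gx <-]]; exists g^-1.
by move=> x y; apply/asboolP/asboolP; exact: H.
Qed.

Lemma orbit_rel_trans : transitive orbit_relb.
Proof.
move=> y x z /asboolP[g [gx gxy]] /asboolP[h [hy hyz]]; apply/asboolP.
move: hy hyz; rewrite -gxy => hy <-; exists (h * g).
by have [? ->] := paM gx hy.
Qed.

Definition orbit_equiv_rel :=
  EquivRel orbit_relb orbit_rel_refl orbit_rel_sym orbit_rel_trans.

Let enveloping_relb : rel (G * X) := fun p q => `[< enveloping_rel p q >].

Lemma enveloping_rel_refl : reflexive enveloping_relb.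
Proof.
move=> [g x]; apply/asboolP; rewrite /enveloping_rel /pa_ran /= mulVg invg1.
exact: pa1.
Qed.

Lemma enveloping_rel_sym : symmetric enveloping_relb.
Proof.
have H p q : enveloping_rel p q -> enveloping_rel q p.
  case: p q => [g x] [h y]; rewrite /enveloping_rel /pa_ran /= !invgM !invgK.
  by move=> [/paV + <-]; rewrite invgM invgK.
by move=> p q; apply/asboolP/asboolP; exact: H.
Qed.

Lemma enveloping_rel_trans : transitive enveloping_relb.
Proof.
move=> [h y] [g x] [k z] /asboolP + /asboolP +; move=> H1 H2; apply/asboolP.
move: H1 H2; rewrite /enveloping_rel /pa_ran /= !invgM !invgK.
move=> [gx <-] [hy <-]; have [] := paM gx hy.
by rewrite mulgA mulgK => ? ->.
Qed.

Definition enveloping_equiv_rel :=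
  EquivRel enveloping_relb
    enveloping_rel_refl enveloping_rel_sym enveloping_rel_trans.

End PartialActionAxioms.

(* Requiring the inverse [h] to be a total self-map of [X] is harmless: a
   partial inverse can be extended by the identity. *)
Definition homeomorphism_on (X : topologicalType) (A B : set X) (f : X -> X) :=
  [/\ set_bij A B f, {within A, continuous f} &
      exists2 h : X -> X, {in A, cancel f h} & {within B, continuous h}].

Definition topological_partial_action
    (G : topologicalGroupType) (X : topologicalType)
    (eta : partial_action G X) : Prop :=
  forall g, open (pa_ran eta g) /\
    homeomorphism_on (pa_ran eta g^-1) (pa_ran eta g) (eta g).

Definition continuous_partial_action
    (G : topologicalGroupType) (X : topologicalType)
    (eta : partial_action G X) : Prop :=
  {within pa_dom eta, continuous (fun p : G * X => eta p.1 p.2)}.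

Definition orbit_space (G : topologicalGroupType) (X : topologicalType)
    (eta : partial_action G X) : topologicalType :=
  quotient_topology {eq_quot orbit_equiv_rel eta}%qT.

Definition enveloping_space (G : topologicalGroupType) (X : topologicalType)
    (eta : partial_action G X) : topologicalType :=
  quotient_topology {eq_quot enveloping_equiv_rel eta}%qT.

Local Open Scope ring_scope.

Definition metrizable (R : realType) (T : topologicalType) : Prop :=
  exists d : T -> T -> R,
    [/\ forall x y, d x y = 0 <-> x = y,
        forall x y, d x y = d y x,
        forall x y z, d x z <= d x y + d y z &
        forall A : set T, open A <->
          (forall x, A x -> exists2 e, 0 < e & [set y | d x y < e] `<=` A)].

Variant space_property := Hausdorff | Regular | Metrizable | SecondCountable.

(* [regular_space] does not include T1; since the Hausdorff case is covered
   as well, this choice also yields the version in which regular means T3. *)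
Definition has_property (R : realType) (P : space_property)
    (T : topologicalType) : Prop :=
  match P with
  | Hausdorff => hausdorff_space T
  | Regular => regular_space T
  | Metrizable => metrizable R T
  | SecondCountable => @second_countable T
  end.

(* Main.v *)
Require Import Defs.
From mathcomp Require Import all_boot all_order all_algebra.
From mathcomp Require Import all_classical all_reals.
From mathcomp Require Import topology.
From mathcomp Require Import lra.

Set Implicit Arguments.
Unset Strict Implicit.
Unset Printing Implicit Defensive.

Import Order.TTheory GRing.Theory Num.Theory.
Local Open Scope classical_set_scope.

(** The projection onto the orbits of a partial action of a compact group with
closed domain is at once open, closed, and has compact fibers; the four
properties descend along any continuous surjection with these features.

Saturations of open sets are open because they are unions of the preimages of
an open set under the homeomorphisms [x |-> g . x], which have open domains
([open_orbit_map]).  Saturations of closed sets are closed because they are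
projections along the compact factor [G] of closed subsets of [G * X]
([closed_orbit_map]); the domain has to be closed for this.  An orbit is the
continuous image of a closed, hence compact, set of group elements
([compact_orbit]).

For an open, closed map with compact fibers: a countable basis is mapped to a
countable basis; closed neighborhoods are mapped to closed
neighborhoods, which gives regularity; a compact fiber
and a point outside it are separated by neighborhoods, which gives the
Hausdorff property.  For metrizability, send each point to its fiber and use
the Hausdorff distance between compact fibers: openness and compactness make
the fiber lower semicontinuous, closedness makes it upper semicontinuous, and
compactness gives every neighborhood of a fiber a uniform radius, so the
Hausdorff distance induces the topology of the base.

The enveloping space needs no separate argument: the relation on [G * X] that
defines it is the orbit relation of the partial action
[k . (g, x) = (g k^-1, k . x)], and this action inherits openness of ranges,
continuity and closedness of the domain from the given one
([enveloping_relE] and the lemmas after it). *)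

(** * Metrics from scaled nearness relations *)

Section MetricFromGauge.
Local Open Scope ring_scope.
Context {R : realType} {Z : topologicalType} (near_by : R -> Z -> Z -> Prop).
Context (near_by_refl : forall (r : R) a, 0 < r -> near_by r a a).
Context (near_by_sym : forall r a b, near_by r a b -> near_by r b a).
Context (near_by_trans : forall r s a b c,
  near_by r a b -> near_by s b c -> near_by (r + s) a c).
Context (near_by_le : forall r s a b, r <= s -> near_by r a b -> near_by s a b).
Context (near_by_sep : forall a b,
  (forall r : R, 0 < r -> near_by r a b) -> a = b).
Context (open_near_by : forall A : set Z, open A <->
  (forall a, A a -> exists2 r : R, 0 < r & [set b | near_by r a b] `<=` A)).

(* Admitting every radius [r >= 1] truncates the distance at 1, so that the
   infimum is over a nonempty set even for points that are near at no scale. *)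
Let radii a b := [set r : R | 0 < r /\ (1 <= r \/ near_by r a b)].
Let gauge_dist a b := inf (radii a b).

Let radii1 a b : radii a b 1. Proof. by split; [lra | left]. Qed.

Let radii_has_inf a b : has_inf (radii a b).
Proof.
split; first by exists 1; exact: radii1.
by exists 0 => r [/ltW].
Qed.

Let gauge_dist_le (r : R) a b : 0 < r -> near_by r a b -> gauge_dist a b <= r.
Proof.
move=> r0 rab; apply: ge_inf; first by case: (radii_has_inf a b).
by split => //; right.
Qed.

Let gauge_dist_ge0 a b : 0 <= gauge_dist a b.
Proof. by apply: lb_le_inf => [|r [/ltW//]]; exists 1; exact: radii1. Qed.

Let gauge_dist_lt (r : R) a b : r <= 1 -> gauge_dist a b < r -> near_by r a b.
Proof.
move=> r1 /(inf_lt (radii_has_inf a b).1) [s [s0 [s1|sab]] sr]; first by lra.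
exact: near_by_le (ltW sr) sab.
Qed.

(** A family of relations [near_by r], read as being at distance at most [r],
that behaves like the family of balls of a metric comes from a metric: take the
infimum of the scales at which two points are near.  This spares handling
suprema of distances when the Hausdorff distance is used below. *)
Lemma metrizable_of_gauge : metrizable R Z.
Proof.
exists gauge_dist; split.
- move=> a b; split=> [ab0|->].
    apply: near_by_sep => r r0.
    have [r1|/ltW r1] := leP r 1.
      by apply: gauge_dist_lt => //; rewrite ab0.
    by apply: near_by_le r1 _; apply: gauge_dist_lt => //; rewrite ab0.
  apply/eqP; rewrite eq_le gauge_dist_ge0 andbT; apply/ler_addgt0Pl => r r0.
  by rewrite addr0; apply: gauge_dist_le => //; exact: near_by_refl.
- move=> a b; congr inf; apply/seteqP.
  by split=> r [r0 [r1|rab]]; split=> //; [left|right; exact: near_by_sym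
                                          |left|right; exact: near_by_sym].
- move=> a b c; apply/ler_addgt0Pl => e e0.
  have e20 : 0 < e / 2 by lra.
  have [r [r0 rab] re] := inf_adherent e20 (radii_has_inf a b).
  have [s [s0 sbc] se] := inf_adherent e20 (radii_has_inf b c).
  have : gauge_dist a c <= r + s.
    apply: ge_inf; first by case: (radii_has_inf a c).
    split; first by lra.
    case: rab sbc => [r1|rab] [s1|sbc]; [left; lra..|].
    by right; exact: near_by_trans rab sbc.
  by rewrite -/(gauge_dist a b) -/(gauge_dist b c) in re se *; lra.
- move=> A; rewrite open_near_by; split=> opA a /opA [r r0 rA].
    have m0 : 0 < Num.min r 1 by rewrite lt_min r0 ltr01.
    exists (Num.min r 1) => // b /= /gauge_dist_lt H; apply: rA => /=.
    by apply: near_by_le (H _); rewrite ge_min lexx ?orbT.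
  exists (r / 2); first by lra.
  move=> b /gauge_dist_le H; apply: rA => /=.
  by apply: le_lt_trans (H _) _; lra.
Qed.

End MetricFromGauge.

(** * Images under open and closed maps with compact fibers *)

Section PerfectOpenMap.
Context {Y Z : topologicalType} (p : Y -> Z).
Context (p_continuous : continuous p) (p_surj : forall z, exists y, p y = z).
Context (p_open : forall U, open U -> open (p @` U)).
Context (p_closed : forall C, closed C -> closed (p @` C)).
Context (p_compact : forall z, compact (p @^-1` [set z])).

Lemma nbhs_image_open_map y (U : set Y) : nbhs y U -> nbhs (p y) (p @` U).
Proof.
rewrite nbhsE => -[V [oV Vy] VU]; apply: (filterS (@image_subset _ _ p _ _ VU)).
by apply: open_nbhs_nbhs; split; [exact: p_open | exists y].
Qed.

(** This is where closedness of [p] enters: the complement of [p @` ~` U] is an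
open set of points whose whole fiber lies in [U]. *)
Lemma nbhs_fiber_closed_map z (U : set Y) :
  open U -> p @^-1` [set z] `<=` U ->
  \forall z' \near z, p @^-1` [set z'] `<=` U.
Proof.
move=> oU zU; have : nbhs z (~` (p @` ~` U)).
  apply: open_nbhs_nbhs; split; first exact/closed_openC/p_closed/open_closedC.
  by move=> [y Uy yz]; exact/Uy/zU.
apply: filterS => z' Nz' y yz'; apply: contrapT => Uy.
by apply: Nz'; exists y.
Qed.

(** A compact fiber and a point [y] outside it are separated by taking a
neighborhood [V] of [y] whose closure misses the fiber.  The images of [V] and
of the complement of [closure V] need not be disjoint, so the neighborhood of
[z1] is the complement of [p @` closure V] instead; it is open because [p] is
closed. *)
Lemma hausdorff_perfect_open_image : hausdorff_space Y -> hausdorff_space Z.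
Proof.
move=> hY z1 z2; have [y <-] := p_surj z2 => zy; apply: contrapT => nzy.
have [V Vy KV] : exists2 V, nbhs y V & p @^-1` [set z1] `<=` ~` closure V.
  (* Compactness is applied with the neighborhoods [V] themselves, ordered by
     inclusion, as the parameter that becomes small. *)
  apply/near_powerset_filter_fromP.
    by move=> U V UV + k /[dup] Kk => /[apply]; apply: contra_not; exact: closureS.
  apply: (iffLR (compact_near_coveringP _)) => // k Kk.
  have /eqP ky : k <> y by move=> ky; apply: nzy; rewrite -ky.
  move: hY; rewrite open_hausdorff => /(_ _ _ ky) [[A B] /= []].
  rewrite !inE => Ak By [oA oB AB0].
  have nB : nbhs y B by exact: open_nbhs_nbhs.
  have nA : nbhs k A by exact: open_nbhs_nbhs.
  near=> k' V.
  have Ak' : A k' by near: k'.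
  have VB : V `<=` B by near: V; exact: small_set_sub.
  move=> /(_ A) []; first exact: open_nbhs_nbhs.
  move=> x [/VB Bx Ax]; have : (A `&` B) x by []; rewrite AB0 => -[].
have clV := @closed_closure _ V.
have Nz1 : nbhs z1 (~` (p @` closure V)).
  apply: open_nbhs_nbhs; split; first exact/closed_openC/p_closed.
  by move=> [v cv vz]; exact: KV vz cv.
have [x [/= Nx [v Vv vx]]] := zy _ _ Nz1 (nbhs_image_open_map Vy).
by apply: Nx; exists v => //; exact: subset_closure.
Unshelve. all: by end_near. Qed.

(** The image of a closed neighborhood is again a closed neighborhood. *)
Lemma regular_open_closed_image : regular_space Y -> regular_space Z.
Proof.
move=> rY z; have [y <-] := p_surj z => W /p_continuous /rY [U Uy UW].
exists (p @` U); first exact: nbhs_image_open_map.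
move=> z' clU; have : (p @` closure U) z'.
  have /closure_id -> : closed (p @` closure U) by exact/p_closed/closed_closure.
  exact: (closureS (@image_subset _ _ p _ _ (@subset_closure _ U)) clU).
by move=> [u /UW ? <-].
Qed.

Lemma second_countable_open_image :
  @second_countable Y -> @second_countable Z.
Proof.
move=> [B cB [oB nB]]; exists [set p @` U | U in B].
  exact: card_le_trans (card_image_le _ _) cB.
split=> [_ [U BU <-]|z]; first exact/p_open/oB.
have [y <-] := p_surj z => W /p_continuous /nB [U [BU Uy] UW].
exists (p @` U); first by split; [exists U | exists y].
by move=> _ [u /UW ? <-].
Qed.

Section Metrizable.
Local Open Scope ring_scope.
Context {R : realType} (d : Y -> Y -> R).
Context (d0 : forall x y, d x y = 0 <-> x = y).
Context (dC : forall x y, d x y = d y x).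
Context (dD : forall x y z, d x z <= d x y + d y z).
Context (d_open : forall A : set Y, open A <->
  (forall x, A x -> exists2 e : R, 0 < e & [set y | d x y < e] `<=` A)).

Let d_ge0 x y : 0 <= d x y.
Proof. by have := dD x y x; rewrite (dC y x) (iffRL (d0 x x))//; lra. Qed.

Let open_ball x (e : R) : open [set y | d x y < e].
Proof.
apply/d_open => y /= ye; exists (e - d x y); first by lra.
by move=> z /=; have := dD x y z; lra.
Qed.

Let nbhs_ball x (e : R) : 0 < e -> nbhs x [set y | d x y < e].
Proof.
move=> e0; apply: open_nbhs_nbhs; split; first exact: open_ball.
by rewrite /= (iffRL (d0 x x)).
Qed.

Let within_nbhd r a b := forall x, p x = a -> exists2 y, p y = b & d x y < r.

(* Up to the choice between strict and weak inequality, the Hausdorff distance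
   of the two fibers is at most [r]. *)
Let fiber_near r a b := within_nbhd r a b /\ within_nbhd r b a.

(* Continuity of the fiber.  The fiber over [z] is approximated by nearby ones
   thanks to openness, uniformly by compactness; nearby fibers stay close to the
   one over [z] thanks to closedness. *)
Let fiber_nearS z (e : R) : 0 < e -> \forall z' \near z, fiber_near e z z'.
Proof.
move=> e0; have e20 : 0 < e / 2 by lra.
have lower : \forall z' \near z, p @^-1` [set z] `<=`
    [set k | exists2 y, p y = z' & d k y < e].
  apply: (iffLR (compact_near_coveringP _)) => // k kz.
  exists ([set k' | d k k' < e / 2], p @` [set y | d k y < e / 2]).
    split=> /=; first exact: nbhs_ball.
    by rewrite -kz; apply: nbhs_image_open_map; exact: nbhs_ball.
  move=> [k' _] /= [kk' [y ky <-]]; exists y => //.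
  by have := dD k' k y; rewrite (dC k' k); lra.
pose U := \bigcup_(k in p @^-1` [set z]) [set y | d k y < e].
have upper : \forall z' \near z, p @^-1` [set z'] `<=` U.
  apply: nbhs_fiber_closed_map.
    by apply: bigcup_open => k _; exact: open_ball.
  by move=> k kz; exists k => //=; rewrite (iffRL (d0 k k)).
apply: filterS2 lower upper => z' zz' z'z; split=> [k /zz' //|y /z'z [k kz ky]].
by exists k => //; rewrite dC.
Qed.

(* A Lebesgue-number argument: the compact fiber over [z] has a uniform
   neighborhood inside the open set [p @^-1` W]. *)
Let fiber_near_sub z (W : set Z) : open W -> W z ->
  exists2 e : R, 0 < e & [set z' | fiber_near e z z'] `<=` W.
Proof.
move=> oW Wz.
have oV : open (p @^-1` W) by move/continuousP: p_continuous; exact.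
have : \forall e \near (0 : R)^'+, p @^-1` [set z] `<=`
    [set k | forall y, d k y < e -> W (p y)].
  apply: (iffLR (compact_near_coveringP _)) => // k kz.
  have [|e e0 eW] := iffLR (d_open _) oV k; first by rewrite /= kz.
  have e20 : 0 < e / 2 by lra.
  exists ([set k' | d k k' < e / 2], [set r | r < e / 2]).
    by split; [exact: nbhs_ball | exact: nbhs_right_lt].
  move=> [k' r] /= [kk' re] y yr; apply: eW => /=.
  by have := dD k k' y; lra.
move=> H; have [e [e0 eW]] : exists e : R, 0 < e /\ p @^-1` [set z] `<=`
    [set k | forall y, d k y < e -> W (p y)].
  apply: (@filter_ex _ (0 : R)^'+); apply: filterI H; exact: nbhs_right_gt.
exists e => // z' [zz' _]; have [k kz] := p_surj z.
by have [y <- ky] := zz' k kz; exact: eW ky.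
Qed.

Let closed_point (z : Z) : closed [set z].
Proof.
have [y <-] := p_surj z; rewrite -image_set1; apply: p_closed.
rewrite -openC; apply/d_open => x /= xy; exists (d x y).
  rewrite lt_neqAle d_ge0 andbT; apply/eqP => /esym /d0; exact: xy.
by move=> w /= + wy; rewrite wy ltxx.
Qed.

(** The Hausdorff distance between fibers metrizes [Z]; points of [Z] are
separated by it since they are closed, being images of points of [Y]. *)
Lemma metrizable_perfect_open_image_of : metrizable R Z.
Proof.
apply: (@metrizable_of_gauge _ _ fiber_near).
- by move=> r a r0; split=> x xa; exists x => //; rewrite (iffRL (d0 x x)).
- by move=> r a b [].
- have T r s a b c : within_nbhd r a b -> within_nbhd s b c ->
      within_nbhd (r + s) a c.
    move=> ab bc x /ab [y /bc [w wc yw] xy]; exists w => //.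
    by have := dD x y w; lra.
  move=> r s a b c [ab ba] [bc cb]; split; first exact: T bc.
  by rewrite addrC; exact: T ba.
- by move=> r s a b rs [ab ba]; split=> x;
    [move/ab | move/ba]; move=> [y ? xy]; exists y => //; lra.
- move=> a b ab; apply: contrapT => neq.
  have [e e0 /(_ b)] : exists2 e : R, 0 < e &
      [set z | fiber_near e a z] `<=` ~` [set b].
    by apply: fiber_near_sub => //; exact/closed_openC/closed_point.
  by apply => //; exact: ab.
- move=> A; split=> [oA a Aa|HA]; first exact: fiber_near_sub.
  rewrite openE => a /HA [e e0 eA]; apply: (filterS eA); exact: fiber_nearS.
Qed.

End Metrizable.

Lemma metrizable_perfect_open_image (R : realType) :
  metrizable R Y -> metrizable R Z.
Proof.
by move=> [d [? ? ? ?]]; exact: (@metrizable_perfect_open_image_of _ d).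
Qed.

Lemma has_property_perfect_open_image (R : realType) (P : space_property) :
  has_property R P Y -> has_property R P Z.
Proof.
case: P.
- exact: hausdorff_perfect_open_image.
- exact: regular_open_closed_image.
- exact: metrizable_perfect_open_image.
- exact: second_countable_open_image.
Qed.

End PerfectOpenMap.

(** * The orbit map of a partial action of a compact group *)

(** The two projections are built from different packagings of the same
quotient structure; since projections are locked, they are equal only after
unlocking. *)
Lemma pi_quotient_topologyE (Y : topologicalType) (Q : quotType Y) :
  \pi_(quotient_topology Q)%qT = \pi_Q%qT :> (Y -> Q).
Proof. by rewrite !unlock. Qed.

Section OrbitMap.
Local Open Scope group_scope.
Context {G : topologicalGroupType} {Y : topologicalType}.
Context (theta : partial_action G Y) (Q : quotType Y).
Context (compactG : compact [set: G]).
Context (ran_open : forall g, open (pa_ran theta g)).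
Context (continuous_theta : continuous_partial_action theta).
Context (closed_dom : closed (pa_dom theta : set (G * Y))).
Context (piE : forall x y : Y,
  \pi_Q%qT x = \pi_Q%qT y <-> orbit_rel theta x y).

Let Z : topologicalType := quotient_topology Q.
Let p : Y -> Z := \pi_(quotient_topology Q)%qT.

Let pE x y : p x = p y <-> orbit_rel theta x y.
Proof. by rewrite /p pi_quotient_topologyE; exact: piE. Qed.

(** Continuity relative to the domain, in the product form in which the
compactness of [G] can be applied to one factor. *)
Lemma partial_action_near g y (U : set Y) :
  pa_dom theta (g, y) -> nbhs (theta g y) U ->
  \forall h \near g & y' \near y, pa_dom theta (h, y') -> U (theta h y').
Proof.
move=> gy Uy; have /subspace_continuousP/(_ _ gy U Uy) := continuous_theta.
by move=> [AB nAB sub]; exists AB => // -[h y'] /sub.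
Qed.

(** A point [y] of the saturation of [U] has [g . y] in [U] for some [g]; by
openness of the domain of [g] and continuity, [g] still carries all points near
[y] into [U]. *)
Lemma open_orbit_map (U : set Y) : open U -> open (p @` U).
Proof.
move=> oU; change (open (p @^-1` (p @` U))); rewrite openE => y [u Uu] /esym.
move=> /pE [g [gy gyu]].
have [|[A B] /= [Ag By] AB] := partial_action_near gy (U := U).
  by apply: open_nbhs_nbhs; rewrite gyu.
have : nbhs y (pa_ran theta g^-1).
  by apply: open_nbhs_nbhs; split; [exact: ran_open | rewrite /pa_ran /= invgK].
apply: filterS2 By => y' By'; rewrite /pa_ran /= invgK => gy'.
exists (theta g y').
  by apply: (AB (g, y')) => //; split=> //=; exact: nbhs_singleton.
by apply/esym/pE; exists g.
Qed.

(** For [y] outside the saturation of [C], each [g] either does not act on [y],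
which persists nearby because the domain is closed, or moves [y] into the open
complement of [C], which persists by continuity.  Compactness of [G] yields one
neighborhood of [y] that works for all [g]. *)
Lemma closed_orbit_map (C : set Y) : closed C -> closed (p @` C).
Proof.
move=> cC; rewrite -openC; change (open (p @^-1` (~` (p @` C)))).
rewrite openE => y /= Cy.
have : \forall y' \near y, [set: G] `<=`
    [set h | pa_dom theta (h, y') -> ~ C (theta h y')].
  apply: (iffLR (compact_near_coveringP _) compactG) => g _.
  have [gy|gy] := pselect (pa_dom theta (g, y)).
    apply: (partial_action_near (U := ~` C)) => //.
    apply: open_nbhs_nbhs; split; first exact: closed_openC.
    by move=> Cgy; apply: Cy; exists (theta g y) => //; apply/esym/pE; exists g.
  have : nbhs (g, y) (~` pa_dom theta).
    by apply: open_nbhs_nbhs; split=> //; exact: closed_openC.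
  by apply: filterS => -[h y'] /= ? ?.
apply: filterS => y' Ny' [c Cc] /esym/pE [h [hy' hc]].
by apply: (Ny' h) => //; rewrite hc.
Qed.

(** The orbit of [y] is the image of the set of all [g] acting on [y], which is
closed in the compact group [G]. *)
Lemma compact_orbit (z : Z) : compact (p @^-1` [set z]).
Proof.
have <- : p (repr z) = z by exact: reprK.
set y := repr z; apply/compact_near_coveringP => I F P FF Pnear.
have : \forall i \near F, [set: G] `<=`
    [set h | pa_dom theta (h, y) -> P i (theta h y)].
  apply: (iffLR (compact_near_coveringP _) compactG) => g _.
  have [gy|gy] := pselect (pa_dom theta (g, y)).
    have [|[A B] /= [Ag FB] AB] := Pnear (theta g y).
      by apply/esym/pE; exists g.
    have [[A' B'] /= [A'g B'y] AB'] := partial_action_near gy Ag.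
    exists (A', B) => // -[h i] /= [A'h Bi] hy.
    apply: (AB (theta h y, i)); split=> //=.
    by apply: (AB' (h, y)) => //; split=> //=; exact: nbhs_singleton.
  have [[A B] /= [Ag By] AB] : nbhs (g, y) (~` pa_dom theta).
    by apply: open_nbhs_nbhs; split=> //; exact: closed_openC.
  exists (A, setT) => /=; first by split=> //; exact: filterT.
  move=> [h i] /= [Ah _] hy; have := AB (h, y); case=> //=.
  by split=> //; exact: nbhs_singleton.
by apply: filterS => i Pi x /esym/pE [h [hy <-]]; exact: Pi.
Qed.

(** The quotient [Q] is only required to identify exactly the points of an
orbit, so that the enveloping space, whose relation is given by another
formula, is covered too. *)
Lemma has_property_orbit_quotient (R : realType) (P : space_property) :
  has_property R P Y -> has_property R P (quotient_topology Q).
Proof.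
apply: (@has_property_perfect_open_image Y Z p).
- exact: pi_continuous.
- by move=> z; exists (repr z); exact: reprK.
- exact: open_orbit_map.
- exact: closed_orbit_map.
- exact: compact_orbit.
Qed.

End OrbitMap.

(** * The enveloping space as an orbit space *)

Section EnvelopingAction.
Local Open Scope group_scope.
Context {G : groupType} {X : Type} (eta : partial_action G X).

(** The action of [k] on [G * X] is [(g, x) |-> (g k^-1, k . x)]: it keeps the
formal product [g . x] unchanged, and the enveloping space is the universal
space in which these formal products make sense. *)
Definition enveloping_dom : set (G * (G * X)) :=
  [set q | pa_dom eta (q.1, q.2.2)].
Definition enveloping_act (k : G) (q : G * X) : G * X :=
  (q.1 * k^-1, eta k q.2).

Lemma enveloping_actV k q : enveloping_dom (k, q) ->
  enveloping_dom (k^-1, enveloping_act k q) /\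
  enveloping_act k^-1 (enveloping_act k q) = q.
Proof.
case: q => g x; rewrite /enveloping_dom /enveloping_act /= => kx.
by have [? ->] := paV kx; rewrite mulgK.
Qed.

Lemma enveloping_actM k l q : enveloping_dom (l, q) ->
  enveloping_dom (k, enveloping_act l q) ->
  enveloping_dom (k * l, q) /\
  enveloping_act k (enveloping_act l q) = enveloping_act (k * l) q.
Proof.
case: q => g x; rewrite /enveloping_dom /enveloping_act /=.
by move=> lx klx; have [? ->] := paM lx klx; rewrite invgM mulgA.
Qed.

Lemma enveloping_act1 q : enveloping_dom (1, q) /\ enveloping_act 1 q = q.
Proof.
case: q => g x; rewrite /enveloping_dom /enveloping_act /=.
by have [? ->] := pa1 eta x; rewrite invg1 mulg1.
Qed.

Definition enveloping_action : partial_action G (G * X) :=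
  PartialAction enveloping_actV enveloping_actM enveloping_act1.

(** If [k . (g, x) = (h, y)] then [h = g k^-1], so [k = h^-1 g] is forced; this
is the group element that occurs in the enveloping relation. *)
Lemma enveloping_relE p q :
  enveloping_rel eta p q <-> orbit_rel enveloping_action p q.
Proof.
case: p q => [g x] [h y]; rewrite /enveloping_rel /pa_ran /= invgM invgK.
split=> [[gx <-]|[k [/= kx [<- <-]]]].
  exists (h^-1 * g); split=> //=.
  by rewrite /enveloping_act /= invgM invgK mulVKg.
by rewrite invgM invgK mulgVK.
Qed.

End EnvelopingAction.

Section EnvelopingTopology.
Context {G : topologicalGroupType} {X : topologicalType}.
Context (eta : partial_action G X).

Lemma open_enveloping_ran : (forall g, open (pa_ran eta g)) ->
  forall g, open (pa_ran (enveloping_action eta) g).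
Proof.
move=> oran g; change (open ((@snd G X) @^-1` pa_ran eta g)).
by apply: open_comp => // q _; exact: cvg_snd.
Qed.

(* The domain of the action on [G * X] and the [X]-component of its values
   depend only on [(k, x)], so they are pulled back along this map. *)
Let dropg : G * (G * X) -> G * X := fun q => (q.1, q.2.2).

Let dropg_continuous : continuous dropg.
Proof.
move=> q; apply: cvg_pair; first exact: cvg_fst.
by apply: cvg_comp; [exact: cvg_snd | exact: cvg_snd].
Qed.

Lemma closed_enveloping_dom : closed (pa_dom eta : set (G * X)) ->
  closed (pa_dom (enveloping_action eta) : set (G * (G * X))).
Proof. by move=> cD; apply: (@preimage_closed _ _ dropg). Qed.

Lemma continuous_enveloping_action : continuous_partial_action eta ->
  continuous_partial_action (enveloping_action eta).
Proof.
move=> ceta; apply/subspace_continuousP => -[k [g x]] /= kx.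
apply: cvg_pair => /=.
  have translate_continuous :
      continuous (fun q : G * (G * X) => (q.2.1 * q.1^-1)%g).
    move=> q; apply: (@continuous_comp _ _ _ (fun q => (q.2.1, (q.1^-1)%g))
      (fun h : G * G => (h.1 * h.2)%g)); last exact: mulg_continuous.
    apply: cvg_pair; first by apply: cvg_comp; [exact: cvg_snd | exact: cvg_fst].
    by apply: cvg_comp; [exact: cvg_fst | exact: invg_continuous].
  apply: cvg_trans (translate_continuous (k, (g, x))).
  by apply: cvg_app; exact: cvg_within.
move=> U /= Ux; have /subspace_continuousP/(_ (k, x) kx U Ux) := ceta.
exact: (dropg_continuous (x := (k, (g, x)))).
Qed.

End EnvelopingTopology.

Theorem theorem3p2 (R : realType) (G : topologicalGroupType)
    (X : topologicalType) (eta : partial_action G X) (P : space_property)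
    (compactG : compact [set: G]) (hausdorffG : hausdorff_space G)
    (topological_eta : topological_partial_action eta)
    (continuous_eta : continuous_partial_action eta)
    (closed_dom : closed (pa_dom eta : set (G * X))) :
  (has_property R P X -> has_property R P (orbit_space eta)) /\
  (has_property R P (G * X)%type -> has_property R P (enveloping_space eta)).
Proof.
have ran_open g : open (pa_ran eta g) by case: (topological_eta g).
have quotE (T : choiceType) (e : equiv_rel T) (x y : T) :
    \pi_{eq_quot e}%qT x = \pi_{eq_quot e}%qT y <-> e x y.
  by split=> /eqmodP.
split; apply: (has_property_orbit_quotient compactG) => //.
- by move=> x y; rewrite quotE; split=> /asboolP.
- exact: open_enveloping_ran.
- exact: continuous_enveloping_action.
- exact: closed_enveloping_dom.
- by move=> q q'; rewrite quotE -enveloping_relE; split=> /asboolP.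
Qed.
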